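(* Let $(G,\cdot)$ be a nonempty quasigroup satisfying the identity $((xy)z)y = x\bigl(y(zy)\bigr)$ for all $x,y,z\in G$. Let $j:G\to G$ be the map $j(x):=x\backslash x$. Then $j$ is constant. Equivalently, $\mathrm{Fix}(j)\cong 1$ in $\mathbf{Set}$, i.e. the set $\mathrm{Fix}(j)=\{x\in G\mid j(x)=x\}$ is a singleton.
   Context: A quasigroup is a set $G$ with a binary operation $\cdot:G\times G\to G$ (also written by juxtaposition) such that for all $a,b\in G$ the equations $a\cdot x=b$ and $y\cdot a=b$ have unique solutions $x$, $y$ in $G$. The left division $a\backslash b$ denotes the unique $x$ with $a\cdot x=b$; thus $j(x)=x\backslash x$ is the unique element with $x\cdot j(x)=x$. No identity element and no associativity are assumed. $\mathrm{Fix}(j)$ is the equalizer of $j$ and $\mathrm{id}_G$ in $\mathbf{Set}$, and $1$ is the terminal object (a one-element set). *)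

(* Defs.v *)
From Stdlib Require Import ClassicalEpsilon.
From Corelib Require Import ssrfun.

Set Implicit Arguments.
Unset Strict Implicit.
Unset Printing Implicit Defensive.

Record quasigroup := Quasigroup {
  carrier :> Type;
  op : carrier -> carrier -> carrier;
  op_solve_right : forall a b : carrier, exists! x : carrier, op a x = b;
  op_solve_left : forall a b : carrier, exists! y : carrier, op y a = b
}.

Declare Scope quasigroup_scope.
Delimit Scope quasigroup_scope with qg.
Notation "x * y" := (op x y) : quasigroup_scope.

(* Unique existence lives in Prop, so extracting the solution as a function
   goes through the description axiom. *)
Definition ldiv_sig (G : quasigroup) (a b : G) : {x : G | op a x = b} :=
  constructive_indefinite_description _
    (let (x, Hx) := op_solve_right a b in ex_intro _ x (proj1 Hx)).

Definition ldiv (G : quasigroup) (a b : G) : G := proj1_sig (ldiv_sig a b).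

Notation "a \ b" := (ldiv a b)
  (at level 40, left associativity) : quasigroup_scope.

Lemma op_ldiv (G : quasigroup) (a b : G) : op a (ldiv a b) = b.
Proof. exact (proj2_sig (ldiv_sig a b)). Qed.

Lemma ldiv_unique (G : quasigroup) (a b x : G) : op a x = b -> ldiv a b = x.
Proof.
intros H. destruct (op_solve_right a b) as [z [_ Hz]].
rewrite <- (Hz _ (op_ldiv a b)). exact (Hz _ H).
Qed.

Definition j (G : quasigroup) (x : G) : G := ldiv x x.

Definition constant_map (A B : Type) (f : A -> B) : Prop :=
  exists b : B, forall x : A, f x = b.

Definition equalizer (A B : Type) (f g : A -> B) : Type := {x : A | f x = g x}.

Definition Fix (A : Type) (f : A -> A) : Type := equalizer f (fun x => x).

(* [bijective f] asks for a two-sided inverse of [f], i.e. that [f] is an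
   isomorphism of sets. *)
Definition iso_Set (A B : Type) : Prop := exists f : A -> B, bijective f.

(* Main.v *)
From Corelib Require Import ssreflect ssrfun ssrbool.
From Stdlib Require Import ProofIrrelevance.
Require Import Defs.

(** Write [R_y] for the right translation [x |-> x * y].  The identity says
    that right translations are closed under a sandwich product: performing
    [R_y], then [R_z], then [R_y] is [R_(y (z y))].

    Choosing [z] with [z y = j y] makes the sandwich equal to [R_y], so [R_z]
    is inverse to [R_y]: every [y] has an element [y'] with
    [(x y) y' = x = (x y') y] and [y' y = j y].  Computing [R_(j y)] through
    such sandwiches gives [y y' = j y] as well, so the local right unit [j y]
    is also a local left unit of [y] ([j_mul]), and then that it is idempotent
    ([j_idempotent]).

    It remains to see that a quasigroup with this identity has at most one
    idempotent ([idempotent_unique]).  For idempotents [e] and [g], the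
    translations [R_e] and [R_g] are involutions, and sandwiching shows that
    [R_(e g)] is inverse to [R_g].  So [g (e g) = (g g) (e g) = g = g g], which
    cancels down to [e = g].  Hence all the values [j x] coincide, and this
    common value is the only fixed point of [j]. *)

Section MoufangQuasigroup.

Local Open Scope quasigroup_scope.

Variable G : quasigroup.

Hypothesis moufang : forall x y z : G, x * y * z * y = x * (y * (z * y)).

Lemma op_cancel_left (a x y : G) : a * x = a * y -> x = y.
Proof.
move=> E; case: (op_solve_right a (a * y)) => z [_ uniq_z].
by rewrite -(uniq_z x E) -(uniq_z y (eq_refl _)).
Qed.

Lemma op_cancel_right (a x y : G) : x * a = y * a -> x = y.
Proof.
move=> E; case: (op_solve_left a (y * a)) => z [_ uniq_z].
by rewrite -(uniq_z x E) -(uniq_z y (eq_refl _)).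
Qed.

Lemma op_j (x : G) : x * j x = x.
Proof. exact: op_ldiv. Qed.

(** With [y' y = j y], the sandwich of [R_y'] between two copies of [R_y] is
    [R_(y (j y)) = R_y], and one copy of [R_y] cancels. *)
Lemma right_translation_inverse (y : G) :
  exists y' : G, [/\ y' * y = j y, forall x, x * y * y' = x
                   & forall x, x * y' * y = x].
Proof.
case: (op_solve_left y (j y)) => y' [y'y _]; exists y'.
have yy' x : x * y * y' = x.
  by apply: (op_cancel_right y); rewrite moufang y'y op_j.
split=> // x; case: (op_solve_left y x) => w [<- _].
by rewrite yy'.
Qed.

(** The sandwich of [R_(y' y')] between copies of [R_y] is [R_(y y')]; but
    [R_(y' y')] is itself the sandwich of [R_(j y)] between copies of the
    inverse translation [R_y'], so that [R_(j y) = R_(y y')]. *)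
Lemma j_right_inverse (y y' : G) :
  y' * y = j y -> (forall x, x * y * y' = x) -> (forall x, x * y' * y = x) ->
  y * y' = j y.
Proof.
move=> y'y yK y'K; apply: (op_cancel_left y).
have jy' : j y * y' = y' by rewrite -y'y yK.
have sandwich : y * y * (y' * y') * y = y * (y * y').
  by rewrite moufang y'K.
by rewrite -sandwich -{2}jy' -moufang yK y'K.
Qed.

Lemma j_mul (y : G) : j y * y = y.
Proof.
case: (right_translation_inverse y) => y' [y'y yK y'K].
by rewrite -(j_right_inverse _ _ y'y yK y'K) y'K.
Qed.

(** As [R_(j y)] fixes [y], so does its inverse; since a right translation is
    determined by its value at [y], it is its own inverse. *)
Lemma mul_j_involutive (x y : G) : x * j y * j y = x.
Proof.
case: (right_translation_inverse (j y)) => e' [_ eK _].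
suff -> : x * j y * j y = x * j y * e' by [].
by congr (_ * _); apply: (op_cancel_left y); rewrite op_j -{2}(op_j y) eK.
Qed.

(** With [e = j y], the sandwich of [R_y] between copies of [R_e] is
    [R_(e (y e)) = R_y]; at [e] this reads [((e e) y) e = y = y e]. *)
Lemma j_idempotent (y : G) : j y * j y = j y.
Proof.
apply: (op_cancel_right y); apply: (op_cancel_right (j y)).
by rewrite moufang op_j !j_mul op_j.
Qed.

Lemma j_of_idempotent (e : G) : e * e = e -> j e = e.
Proof. exact: ldiv_unique. Qed.

Lemma mul_idempotent_involutive (e x : G) : e * e = e -> x * e * e = x.
Proof. by move=> /j_of_idempotent {1 2}<-; rewrite mul_j_involutive. Qed.

(** Put [u = e g].  As [R_e] and [R_g] are involutions, the sandwich of [R_e]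
    between copies of [R_g] fixes [u], that is, [u (g u) = u].  Hence the
    sandwich of [R_g] between copies of [R_u] is [R_(u (g u)) = R_u], and
    [R_u] following [R_g] is the identity. *)
Lemma idempotent_unique (e g : G) : e * e = e -> g * g = g -> e = g.
Proof.
move=> ee gg; pose u := e * g.
have u_gu : u * (g * u) = u.
  by rewrite -moufang mul_idempotent_involutive // ee.
have gu : g * u = g.
  (* The identity has to be applied at the [m] that [R_u] sends to [g]. *)
  case: (op_solve_left u g) => m [mu _].
  by rewrite -{1}gg -{1}mu moufang u_gu.
apply: (op_cancel_right g); apply: (op_cancel_left g).
by rewrite gu !gg.
Qed.

Lemma j_constant (x y : G) : j x = j y.
Proof. by apply: idempotent_unique; exact: j_idempotent. Qed.

End MoufangQuasigroup.

Theorem theorem5p4 (G : quasigroup) (G_nonempty : inhabited G)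
  (G_identity : forall x y z : G,
     (((x * y) * z) * y = x * (y * (z * y)))%qg) :
  constant_map (@j G) /\
  iso_Set (Fix (@j G)) unit /\
  (exists! x : G, j x = x).
Proof.
case: G_nonempty => a.
have j_a x : j x = j a by exact: j_constant.
split; first by exists (j a).
split; last by exists (j a); split=> // x <-; rewrite j_a.
exists (fun=> tt), (fun=> exist (fun x => j x = x) (j a) (j_a (j a))).
- move=> [x fix_x].
  apply: subset_eq_compat; by rewrite -(j_a x).
- by case.
Qed.
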